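(* Let $\lambda\in\mathbb{Z}$ and suppose $f\in\mathbb{K}(x)$ is $\lambda$-Mahler summable. (1) If $\infty\in\mathrm{supp}(f)$ and either $\lambda=0$ or $f_\infty\notin\mathbb{K}$, then $\mathrm{disp}(f,\infty)>0$. (2) If $\lambda\leq0$ then $\mathrm{disp}(f,\tau)>0$ for every Mahler tree $\tau\in\mathrm{supp}(f)$. (3) If $\lambda\geq1$ and $\tau\in\mathrm{supp}(f)$ is a Mahler tree such that either $\tau\in\mathcal{T}_0$ or $\mathrm{ord}(f,\tau)\neq\lambda$, then $\mathrm{disp}(f,\tau)>0$.
   Context: $\mathbb{K}$ is an algebraically closed field of characteristic zero, $p\ge2$ a fixed integer, $\sigma(f(x))=f(x^p)$, $\Delta_\lambda:=p^\lambda\sigma-\mathrm{id}$; $f$ is $\lambda$-Mahler summable if $f=\Delta_\lambda(g)$ for some $g\in\mathbb{K}(x)$. Every $f\in\mathbb{K}(x)$ decomposes uniquely as $f=f_\infty+f_{\mathcal{T}}$, $f_\infty\in\mathbb{K}[x,x^{-1}]$, $f_{\mathcal{T}}=a/b$ with $a=0$ or $\deg a<\deg b$, $\gcd(a,b)=1=\gcd(x,b)$. Mahler trees are the classes of $\mathbb{K}^\times$ under $\alpha\sim\gamma\iff\alpha^{p^r}=\gamma^{p^s}$ ($r,s\ge0$). For a tree $\tau$, $\mathcal{C}(\tau)$ is the set of elements of $\tau$ that are roots of unity of order coprime to $p$; $\mathcal{T}_0$ is the set of trees with $\mathcal{C}(\tau)=\emptyset$. Mahler support: $\infty\in\mathrm{supp}(f)$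 iff $f_\infty\ne0$; a tree $\tau\in\mathrm{supp}(f)$ iff $\tau$ contains a pole of $f$; $\mathrm{sing}(f,\tau)$ is the set of poles of $f$ in $\tau$ and $\mathrm{ord}(f,\tau):=\max(\{0\}\cup\{\mathrm{ord}_\alpha f:\alpha\in\mathrm{sing}(f,\tau)\})$. Mahler dispersion, for $\tau\in\mathrm{supp}(f)$: if $\tau$ is a tree, $\mathrm{disp}(f,\tau)$ is the largest $d\ge0$ for which some $\alpha\in\mathrm{sing}(f,\tau)$ has $\alpha^{p^d}\in\mathrm{sing}(f,\tau)$, and $\infty$ if there is no largest such $d$. For $\tau=\infty$, writing $f_\infty=\sum_ic_ix^i$: if $f_\infty=c_0\ne0$ then $\mathrm{disp}(f,\infty)=0$; otherwise it is the largest $d\ge0$ such that some $i\ne0$ has $c_i\ne0$ and $c_{ip^d}\ne0$. *)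

(* Defs.v *)
From HB Require Import structures.
From mathcomp Require Import all_boot all_order all_algebra.
From mathcomp Require Import finmap generic_quotient.
From mathcomp Require Import boolp classical_sets functions cardinality fsbigop.
From mathcomp Require Import constructive_ereal.
From mathcomp Require Import zify ring.

Set Implicit Arguments.
Unset Strict Implicit.
Unset Printing Implicit Defensive.

Import Order.TTheory GRing.Theory Num.Theory.

Local Open Scope classical_set_scope.
Local Open Scope ring_scope.
Local Open Scope quotient_scope.

Notation "x %:F" := (@FracField.tofrac _ x) : ring_scope.

Section RationalFunctions.
Variable K : fieldType.
Implicit Types (f : {fraction {poly K}}) (a b : {poly K}).

(* f(x) |-> f(x^p), computed on the fraction chosen by repr;
   mahler_sigma_div shows that the choice is irrelevant for p > 0 *)
Definition mahler_sigma (p : nat) f : {fraction {poly K}} :=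
  (\n_(repr f) \Po 'X^p)%:F / (\d_(repr f) \Po 'X^p)%:F.

Definition mahler_delta (p : nat) (lam : int) f : {fraction {poly K}} :=
  p%:R ^ lam * mahler_sigma p f - f.

Definition mahler_summable (p : nat) (lam : int) f : Prop :=
  exists g, f = mahler_delta p lam g.

(* denominator of f in lowest terms, up to a nonzero constant *)
Definition reduced_denom f : {poly K} :=
  \d_(repr f) %/ gcdp \n_(repr f) \d_(repr f).

(* order of alpha as a pole of f: nonnegative, 0 when alpha is not a pole *)
Definition pole_order f (alpha : K) : nat := mup alpha (reduced_denom f).

Definition pole f (alpha : K) : Prop := (0 < pole_order f alpha)%N.

(* c represents the Laurent polynomial \sum_i c_i x^i *)
Definition laurent := {fsfun int -> K with 0}.

Definition laurent_frac (c : laurent) : {fraction {poly K}} :=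
  \sum_(i <- finsupp c) (c i)%:P%:F * 'X%:F ^ i.

Definition mahler_decomp f (c : laurent) (a b : {poly K}) : Prop :=
  [/\ f = laurent_frac c + a%:F / b%:F,
      a = 0 \/ (size a < size b)%N, coprimep a b & coprimep 'X b].

Lemma repr_div f : f = (\n_(repr f))%:F / (\d_(repr f))%:F.
Proof.
have dn0 := denom_ratioP (repr f).
apply: (canRL (mulfK _)); first by rewrite tofrac_eq0.
rewrite -{1}[f]reprK; move: (repr f) dn0 => x dn0.
rewrite /FracField.tofrac; unlock.
rewrite /FracField.tofrac /GRing.mul /= !piE /=.
by apply/eqmodP; rewrite /= FracField.equivfE /FracField.mulf
   !numden_Ratio ?oner_neq0 ?mulr1 // mulrC.
Qed.

Lemma div_crossE a b a' b' : b != 0 -> b' != 0 ->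
  (a%:F / b%:F == a'%:F / b'%:F) = (a * b' == a' * b).
Proof.
move=> b0 b'0; rewrite -[in RHS]tofrac_eq !tofracM.
by rewrite eqr_div ?tofrac_eq0.
Qed.

Lemma repr_cross a b : b != 0 ->
  a * \d_(repr (a%:F / b%:F)) = \n_(repr (a%:F / b%:F)) * b.
Proof.
move=> b0; apply/eqP; rewrite -div_crossE ?denom_ratioP //.
by rewrite -repr_div.
Qed.

Lemma mahler_sigma_div (p : nat) a b : (0 < p)%N -> b != 0 ->
  mahler_sigma p (a%:F / b%:F) = (a \Po 'X^p)%:F / (b \Po 'X^p)%:F.
Proof.
move=> p0 b0.
have c0 q : q != 0 -> q \Po 'X^p != 0 :> {poly K}.
  by rewrite comp_poly_eq0 // size_polyXn ltnS.
apply/eqP; rewrite div_crossE ?c0 ?denom_ratioP //.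
by rewrite -!comp_polyM repr_cross // mulrC.
Qed.

Lemma reduced_denom_div a b : b != 0 -> coprimep a b ->
  reduced_denom (a%:F / b%:F) %= b.
Proof.
move=> b0 cab; rewrite /reduced_denom.
have := repr_cross a b0; have := denom_ratioP (repr (a%:F / b%:F)).
move: \d_ _ \n_ _ => d n d0 e.
set g := gcdp n d.
have g0 : g != 0 by rewrite gcdp_eq0 negb_and d0 orbT.
have ed : d %/ g * g = d by rewrite divpK // dvdp_gcdr.
have en : n %/ g * g = n by rewrite divpK // dvdp_gcdl.
have e' : a * (d %/ g) = n %/ g * b.
  by apply: (mulIf g0); rewrite -mulrA ed mulrAC en.
have co : coprimep (n %/ g) (d %/ g).
  by apply: coprimep_div_gcd; rewrite d0 orbT.
apply/andP; split.
- have : d %/ g %| n %/ g * b by rewrite -e' dvdp_mull.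
  by rewrite Gauss_dvdpr // coprimep_sym.
- have : b %| a * (d %/ g) by rewrite e' dvdp_mull.
  by rewrite Gauss_dvdpr // coprimep_sym.
Qed.

Lemma reduced_denom_neq0 f : reduced_denom f != 0.
Proof.
by rewrite dvdp_div_eq0 ?dvdp_gcdr // denom_ratioP.
Qed.

Lemma pole_order_div a b (alpha : K) : b != 0 -> coprimep a b ->
  pole_order (a%:F / b%:F) alpha = mup alpha b.
Proof.
move=> b0 cab; rewrite /pole_order.
have h := reduced_denom_div b0 cab.
have q0 := reduced_denom_neq0 (a%:F / b%:F).
apply/eqP; rewrite eqn_leq; apply/andP; split.
- by rewrite mup_geq // -(eqp_dvdr _ h) -mup_geq.
- by rewrite mup_geq // (eqp_dvdr _ h) -mup_geq.
Qed.

Lemma laurent_fracE (c : laurent) (m : nat) (P : {poly K}) :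
  (forall j : nat, c (j%:Z - m%:Z) = P`_j) ->
  (forall i : int, i < - m%:Z -> c i = 0) ->
  laurent_frac c = P%:F / ('X^m)%:F.
Proof.
move=> cP c0.
have X0 : ('X : {poly K})%:F != 0 by rewrite tofrac_eq0 polyX_eq0.
rewrite /laurent_frac.
rewrite (perm_big [seq i <- [seq (j%:Z - m%:Z) | j <- iota 0 (size P)]
                        | c i != 0]) /=; last first.
  apply: uniq_perm; first exact: fset_uniq.
    rewrite filter_uniq // map_inj_uniq ?iota_uniq //.
    by move=> i j /addIr [].
  move=> i; rewrite mem_filter mem_finsupp.
  case: (boolP (c i != 0)) => //= ci; apply/esym/mapP.
  have im : 0 <= i + m%:Z.
    rewrite -(opprK m%:Z) subr_ge0 leNgt; apply/negP => /c0 ci0.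
    by rewrite ci0 eqxx in ci.
  have [j ej] : exists j : nat, i + m%:Z = j%:Z.
    by case: (i + m%:Z) im => // j _; exists j.
  have ei : i = j%:Z - m%:Z by rewrite -ej addrK.
  exists j => //; rewrite mem_iota /= add0n ltnNge; apply/negP => sj.
  by move: ci; rewrite ei cP nth_default // eqxx.
rewrite big_filter big_map.
rewrite -{2}(coefK P) poly_def.
rewrite (big_morph _ (@tofracD _) (@tofrac0 _)) mulr_suml.
rewrite -[iota 0 _]/(iota 0 (size P)) -{1}(subn0 (size P)) -/(index_iota 0 _).
rewrite big_mkcond big_mkord; apply: eq_bigr => j _.
rewrite cP -mul_polyC tofracM !tofracXn -mulrA expfzDr // -exprnN.
by case: eqP => //= ->; rewrite tofrac0 mul0r.
Qed.

Lemma laurent_bound (c : laurent) : exists M : nat,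
  forall i : int, (M < `|i|)%N -> c i = 0.
Proof.
exists (\max_(i <- finsupp c) `|i|%N) => i.
apply: contraTeq; rewrite -mem_finsupp -leqNgt => h.
exact: (@leq_bigmax_seq _ _ xpredT (fun i : int => `|i|%N)).
Qed.

Lemma laurent_polyP (c : laurent) (m : nat) :
  (forall i : int, (m < `|i|)%N -> c i = 0) ->
  let P := \poly_(j < m.*2.+1) c (j%:Z - m%:Z) in
  (forall j : nat, c (j%:Z - m%:Z) = P`_j) /\
  laurent_frac c = P%:F / ('X^m)%:F.
Proof.
move=> cm P.
have cP j : c (j%:Z - m%:Z) = P`_j.
  rewrite coef_poly; case: ltnP => // lj; apply: cm; lia.
split=> //; apply: laurent_fracE => // i im; apply: cm; lia.
Qed.

Lemma ltn_size_mulr a b q : a != 0 -> b != 0 -> q != 0 ->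
  (size (a * q)%R < size (b * q)%R)%N = (size a < size b)%N.
Proof.
have aux (x y z : nat) : (0 < x)%N -> (0 < z)%N ->
  ((x + z).-1 < (y + z).-1)%N = (x < y)%N by lia.
by move=> a0 b0 q0; rewrite !size_mul // aux // size_poly_gt0.
Qed.

Lemma mahler_decomp_exists f : exists c a b, mahler_decomp f c a b.
Proof.
have [n [d d0 ef]] : exists n, exists2 d, d != 0 & f = n%:F / d%:F.
  by exists \n_(repr f), \d_(repr f); [exact: denom_ratioP|exact: repr_div].
have [m [d' nr ed]] : exists m, exists2 d', ~~ root d' 0 & d = d' * 'X^m.
  have [m [d' /implyP/(_ d0) nr ed]] := multiplicity_XsubC d 0.
  by exists m, d' => //; rewrite {1}ed subr0.
have d'0 : d' != 0 by apply: contraNneq nr => ->; rewrite root0.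
have cX : coprimep 'X d'.
  by rewrite -['X]subr0 -polyC0 coprimep_sym coprimep_XsubC.
have /Bezout_eq1_coprimepP [[u v] /= uv] : coprimep d' 'X^m.
  by rewrite coprimep_sym coprimep_expl.
pose P := n * u + (n * v %/ d') * 'X^m.
pose r := n * v %% d'.
pose g := gcdp r d'.
have g0 : g != 0 by rewrite gcdp_eq0 negb_and d'0 orbT.
have ed' : d' %/ g * g = d' by rewrite divpK // dvdp_gcdr.
have er : r %/ g * g = r by rewrite divpK // dvdp_gcdl.
have b0 : d' %/ g != 0 by rewrite dvdp_div_eq0 // dvdp_gcdr.
pose s : {fset int} := [fset (j%:Z - m%:Z) | j in iota 0 (size P)]%fset.
pose c : laurent := [fsfun i in s => P`_(absz ((i : int) + m%:Z)%R)].
have cP (j : nat) : c (j%:Z - m%:Z) = P`_j.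
  rewrite fsfunE subrK absz_nat; case: ifPn => // js.
  rewrite nth_default // leqNgt; apply: contraNN js => js.
  by apply/imfsetP; exists j => //=; rewrite mem_iota.
have c0 (i : int) : i < - m%:Z -> c i = 0.
  move=> im; rewrite fsfunE; case: ifPn => // /imfsetP [j _ ej].
  by move: im; rewrite ej; lia.
have Xm0 : 'X^m != 0 :> {poly K} by rewrite monic_neq0 // monicXn.
exists c, (r %/ g), (d' %/ g); split.
- rewrite (laurent_fracE cP c0) ef ed addf_div ?tofrac_eq0 //.
  rewrite -!tofracM -tofracD; apply/eqP.
  rewrite div_crossE ?mulf_neq0 //; apply/eqP.
  have er' : r = n * v - (n * v %/ d') * d'.
    by rewrite [X in X - _](divp_eq _ d') addrC addKr.
  have key : n = P * d' + r * 'X^m.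
    rewrite er' /P -[LHS]mulr1 -uv; ring.
  transitivity ((P * (d' %/ g * g) + (r %/ g * g) * 'X^m) * ('X^m * (d' %/ g))).
    by rewrite ed' er -key.
  transitivity ((P * (d' %/ g) + r %/ g * 'X^m) * ((d' %/ g * g) * 'X^m)).
    ring.
  by rewrite ed'.
- right; have := ltn_modp (n * v) d'; rewrite d'0 -/r => szr.
  have [->|a0] := eqVneq (r %/ g) 0; first by rewrite size_poly0 size_poly_gt0.
  by rewrite -(@ltn_size_mulr _ _ g) // er ed'.
- by apply: coprimep_div_gcd; rewrite d'0 orbT.
- by move: cX; rewrite -{1}ed' coprimepMr => /andP[].
Qed.

Lemma mahler_decomp_unique f c a b c' a' b' :
  mahler_decomp f c a b -> mahler_decomp f c' a' b' ->
  c = c' /\ a%:F / b%:F = a'%:F / b'%:F.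
Proof.
move=> [ef szab _ cXb] [ef' szab' _ cXb'].
have nz q : coprimep 'X q -> q != 0 :> {poly K}.
  by move=> cq; apply/eqP => q0; move: cq;
     rewrite q0 coprimep0 -size_poly_eq1 size_polyX.
have b0 := nz _ cXb; have b0' := nz _ cXb'.
have [M hM] := laurent_bound c; have [M' hM'] := laurent_bound c'.
pose m := maxn M M'.
have [] := @laurent_polyP c m; first by move=> i im; apply: hM; lia.
set P := \poly_(_ < _) _ => cP eP.
have [] := @laurent_polyP c' m; first by move=> i im; apply: hM'; lia.
set P' := \poly_(_ < _) _ => cP' eP'.
have Xm0 : 'X^m != 0 :> {poly K} by rewrite monic_neq0 // monicXn.
have eq : (P - P') * (b * b') = 'X^m * (a' * b - a * b').
  have : P%:F / ('X^m)%:F + a%:F / b%:F = P'%:F / ('X^m)%:F + a'%:F / b'%:F.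
    by rewrite -eP -eP' -ef -ef'.
  rewrite !addf_div ?tofrac_eq0 // -!tofracM -!tofracD => /eqP.
  rewrite div_crossE ?mulf_neq0 // => /eqP e.
  apply: (mulIf Xm0).
  transitivity ((P * b + a * 'X^m) * ('X^m * b')
                - (P' * b' * ('X^m * b) + a * 'X^m * ('X^m * b'))); first by ring.
  rewrite e; ring.
have sz : (size (a' * b - a * b')%R < size (b * b')%R)%N.
  have aux (x y z : {poly K}) : y != 0 -> z != 0 ->
      x = 0 \/ (size x < size y)%N -> (size (x * z)%R < size (y * z)%R)%N.
    move=> y0 z0 [->|sxy]; first by rewrite mul0r size_poly0 size_poly_gt0 mulf_neq0.
    have [->|x0] := eqVneq x 0.
      by rewrite mul0r size_poly0 size_poly_gt0 mulf_neq0.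
    by rewrite ltn_size_mulr.
  apply: leq_ltn_trans (size_polyD _ _) _; rewrite size_polyN gtn_max.
  by apply/andP; split; [rewrite (mulrC b)|]; apply: aux.
have /dvdpP [Q eQ] : 'X^m %| P - P'.
  have : 'X^m %| (P - P') * (b * b') by rewrite eq dvdp_mulr.
  by rewrite Gauss_dvdpl // coprimep_expl // coprimepMr cXb.
have eQ' : Q * (b * b') = a' * b - a * b'.
  by apply: (mulfI Xm0); rewrite -eq eQ; ring.
have Q0 : Q = 0.
  apply/eqP/negPn/negP => Q0; move: sz; rewrite -eQ' -[b * b']mul1r.
  by rewrite mulrA mulr1 ltn_size_mulr ?oner_neq0 ?mulf_neq0 // size_poly1
     ltnS leqn0 size_poly_eq0 (negPf Q0).
have ePP : P = P' by apply/eqP; rewrite -subr_eq0 eQ Q0 mul0r.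
split.
  apply/fsfunP => i.
  have [im|im] := ltnP m `|i|%N.
    by rewrite hM ?hM' //; apply: leq_ltn_trans im; rewrite ?leq_maxr ?leq_maxl.
  have [j ->] : exists j : nat, i = j%:Z - m%:Z.
    by move: (i : int) im => {}i im; exists (absz (i + m%:Z)%R); lia.
  by rewrite cP cP' ePP.
by have := etrans (esym ef) ef'; rewrite eP eP' ePP => /addrI.
Qed.

(* Laurent part of f; well-defined by mahler_decomp_unique *)
Definition f_infty f : laurent := projT1 (cid (mahler_decomp_exists f)).

Lemma f_inftyP f : exists a b, mahler_decomp f (f_infty f) a b.
Proof. by rewrite /f_infty; case: cid. Qed.

Lemma pole_root f (alpha : K) : pole f alpha <-> root (reduced_denom f) alpha.
Proof.
by rewrite /pole /pole_order -XsubC_dvd ?reduced_denom_neq0 // dvdp_XsubCl.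
Qed.

Lemma finite_poles f : finite_set (pole f).
Proof.
have aux n (q : {poly K}) : (size q <= n)%N -> q != 0 ->
    exists s : seq K, forall x, root q x -> x \in s.
  elim: n q => [|n IHn] q; first by rewrite leqn0 size_poly_eq0 => ->.
  move=> szq q0; have [[x qx]|nox] := pselect (exists x, root q x); last first.
    by exists [::] => x qx; case: nox; exists x.
  have [q' eq] := factor_theorem q x qx.
  have q'0 : q' != 0 by apply: contraNneq q0 => q'0; rewrite eq q'0 mul0r.
  have [|s hs] := IHn q' _ q'0.
    by move: szq; rewrite eq size_Mmonic ?monicXsubC // size_XsubC addn2.
  exists (x :: s) => y; rewrite eq rootM root_XsubC inE orbC.
  by case: eqP => //= _ /hs.
have [s hs] := aux _ _ (leqnn _) (reduced_denom_neq0 f).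
apply: (@sub_finite_set _ _ [set` s]); last exact: finite_seq.
by move=> x /pole_root /hs.
Qed.

End RationalFunctions.

Section MahlerTrees.
Variables (K : fieldType) (p : nat).
Implicit Types (f : {fraction {poly K}}) (tau : set K).

Definition mahler_equiv (alpha gamma : K) : Prop :=
  exists r s : nat, alpha ^+ (p ^ r) = gamma ^+ (p ^ s).

Definition is_mahler_tree tau : Prop :=
  exists2 alpha, alpha != 0 &
    tau = [set gamma | gamma != 0 /\ mahler_equiv alpha gamma].

Definition tree_cycle tau : set K :=
  [set zeta | tau zeta /\
     exists2 n : nat, coprime n p & n.-primitive_root zeta].

Definition tree_T0 tau : Prop := is_mahler_tree tau /\ tree_cycle tau = set0.

(* a Mahler tree or infinity; AtTree accepts any set, and mahler_supp only
   selects sets that are Mahler trees *)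
Inductive mahler_place := AtInfty | AtTree of set K.

Definition mahler_supp f : set mahler_place := fun pl =>
  match pl with
  | AtInfty => laurent_frac (f_infty f) != 0
  | AtTree tau => is_mahler_tree tau /\ exists2 alpha, tau alpha & pole f alpha
  end.

Definition sing f tau : set K := [set alpha | tau alpha /\ pole f alpha].

(* sing f tau is finite by finite_poles, so the big maximum ranges over all of
   it; its neutral element 0 accounts for the {0} in max({0} U ...) *)
Definition mahler_ord f tau : nat :=
  \big[maxn/0%N]_(alpha \in sing f tau) pole_order f alpha.

(* largest element of D, +oo if there is none *)
Definition largest (D : set nat) : \bar int :=
  if pselect (exists2 d, D d & forall e, D e -> (e <= d)%N) is left h
  then ((projT1 (cid2 h))%:Z)%:E else +oo%E.

Definition disp_infty f : \bar int :=
  let c := f_infty f in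
  if pselect (exists c0 : K, laurent_frac c = c0%:P%:F) then 0%:E
  else largest [set d | exists i : int,
                  [/\ i != 0, c i != 0 & c (i * p%:Z ^+ d) != 0]].

Definition disp_tree f tau : \bar int :=
  largest [set d | exists2 alpha, sing f tau alpha &
                                  sing f tau (alpha ^+ (p ^ d))].

(* as a dispersion this is meaningful only for places in mahler_supp f *)
Definition disp f (pl : mahler_place) : \bar int :=
  match pl with
  | AtInfty => disp_infty f
  | AtTree tau => disp_tree f tau
  end.

End MahlerTrees.

Arguments AtInfty {K}.

(* Main.v *)
(* Write f = p^lam sigma(g) - g. For x <> 0 in characteristic 0, sigma(g) has at
   x a pole of the same order as g at x^p, so wherever f is regular the pole
   orders of g at x and at x^p agree.

   Suppose f has a pole beta in a tree of dispersion 0. Then f is regular at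
   beta^(p^j) for j >= 1, so g has the same order m at all these points. If
   m > 0, finiteness of the poles of g makes the orbit reach a cycle of roots of
   unity of order prime to p, and comparing leading polar coefficients around
   that cycle forces m = lam. If moreover beta is not a pole of g, then f has
   order lam at beta. Otherwise (in particular if m = 0), beta is a pole of g,
   and following p-th roots of beta backwards meets either a pole of f or a
   repetition; both give a positive dispersion.

   For the Laurent part, c_f(p i) = p^lam c_g(i) - c_g(p i) and c_f(i) = - c_g(i)
   when p does not divide i. If j <> 0 has c_g(j) <> 0 with |j| minimal and a is
   maximal with c_g(j p^a) <> 0, then c_f is nonzero at j and at j p^(a+1). *)

Require Import Defs.
From mathcomp Require Import all_boot all_order all_algebra.
From mathcomp Require Import finmap boolp.
From mathcomp Require Import classical_sets cardinality fsbigop constructive_ereal.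
From mathcomp Require Import zify ring.

Import Order.TTheory GRing.Theory Num.Theory.
Local Open Scope ring_scope.

Set Implicit Arguments.
Unset Strict Implicit.
Unset Printing Implicit Defensive.

(** * Pole orders and leading polar coefficients *)

Section PoleOrders.
Variable K : fieldType.
Implicit Types (f g h : {fraction {poly K}}) (A B : {poly K}) (x c u : K).

Lemma frac_reduced f :
  exists A B, [/\ B != 0, coprimep A B & f = A%:F / B%:F].
Proof.
have d0 := denom_ratioP (repr f).
set n := \n_(repr f); set d := \d_(repr f) in d0 *; set g := gcdp n d.
have g0 : g != 0 by rewrite gcdp_eq0 negb_and d0 orbT.
have ed : d %/ g * g = d by rewrite divpK // dvdp_gcdr.
have en : n %/ g * g = n by rewrite divpK // dvdp_gcdl.
have dg0 : d %/ g != 0 by rewrite dvdp_div_eq0 // dvdp_gcdr.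
exists (n %/ g), (d %/ g); split=> //.
  by apply: coprimep_div_gcd; rewrite d0 orbT.
rewrite [LHS]repr_div; apply/eqP.
by rewrite div_crossE // -/n -/d -{1}en -{2}ed mulrAC mulrA.
Qed.

(* c is the coefficient of (X - x)^-m in g; in particular the order of the pole
   of g at x is at most m. *)
Definition polar_coef g x (m : nat) c : Prop :=
  exists A B, [/\ ~~ root B x, g = A%:F / (('X - x%:P) ^+ m * B)%:F
                & A.[x] = c * B.[x]].

Lemma XsubC_exp_neq0 x m : ('X - x%:P) ^+ m != 0 :> {poly K}.
Proof. by rewrite expf_neq0 // polyXsubC_eq0. Qed.

Lemma nroot_neq0 B x : ~~ root B x -> B != 0.
Proof. by apply: contraNneq => ->; rewrite root0. Qed.

(** In lowest terms the numerator cannot vanish at a pole. At order 0 the coefficient is the value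
    of g at x, which may be 0. *)
Lemma polar_coef_order g x : exists c,
  polar_coef g x (pole_order g x) c /\ ((0 < pole_order g x)%N -> c != 0).
Proof.
have [A [B [B0 co ->]]] := frac_reduced g.
rewrite pole_order_div //; set m := mup x B.
have /dvdpP [B' eB] : ('X - x%:P) ^+ m %| B by rewrite -mup_geq.
have nB' : ~~ root B' x.
  apply/negP => /factor_theorem [C eC].
  suff : (m.+1 <= m)%N by rewrite ltnn.
  by rewrite {2}/m mup_geq // eB eC -mulrA -exprS dvdp_mulIr.
exists (A.[x] / B'.[x]); split.
  by exists A, B'; split; rewrite ?divfK // [_ * B']mulrC -eB.
move=> m0; rewrite mulf_neq0 ?invr_eq0 //.
apply: contraL co => /eqP rA.
rewrite -gcdp_eqp1 -size_poly_eq1 gtn_eqF //.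
have : 'X - x%:P %| gcdp A B.
  rewrite dvdp_gcd dvdp_XsubCl /root rA eqxx /=.
  by rewrite XsubC_dvd.
move/dvdp_leq; rewrite size_XsubC; apply.
by rewrite gcdp_eq0 negb_and B0 orbT.
Qed.

(** Compare with lowest terms N/D: D divides (X - x)^m B with B(x) nonzero, and if A(x) is nonzero
    then (X - x)^m divides D. *)
Lemma polar_coef_bound g x m c : polar_coef g x m c ->
  (pole_order g x <= m)%N /\ (c != 0 -> pole_order g x = m).
Proof.
move=> [A [B [rB eg ec]]].
have [N [D [D0 co eg']]] := frac_reduced g.
have B0 := nroot_neq0 rB.
have Y0 := XsubC_exp_neq0 x m.
have e : N * (('X - x%:P) ^+ m * B) = A * D.
  by apply/eqP; rewrite -div_crossE ?mulf_neq0 // -eg' -eg.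
rewrite eg' pole_order_div //.
have le : (mup x D <= m)%N.
  have : D %| ('X - x%:P) ^+ m * B.
    by rewrite -(@Gauss_dvdpr _ _ N) ?e ?dvdp_mull // coprimep_sym.
  move=> dD; have -> : m = mup x (('X - x%:P) ^+ m * B).
    by rewrite mupM // mup_XsubCX eqxx mupNroot // addn0.
  by rewrite mup_geq ?mulf_neq0 //; apply: dvdp_trans dD; rewrite -mup_geq.
split=> // c0; apply/eqP; rewrite eqn_leq le /= mup_geq //.
have : ('X - x%:P) ^+ m %| A * D by rewrite -e mulrCA dvdp_mulr.
rewrite Gauss_dvdpr // coprimep_expl // coprimep_sym coprimep_XsubC.
by rewrite /root ec mulf_neq0.
Qed.

Lemma polar_coefW g x m n c : polar_coef g x m c -> (m < n)%N ->
  polar_coef g x n 0.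
Proof.
move=> [A [B [rB -> _]]] mn.
have B0 := nroot_neq0 rB.
exists (A * ('X - x%:P) ^+ (n - m)), B; split=> //.
  apply/eqP; rewrite div_crossE ?mulf_neq0 ?XsubC_exp_neq0 //.
  by rewrite -[in X in X == _](subnK (ltnW mn)) exprD; apply/eqP; ring.
by rewrite hornerM horner_exp !hornerE subrr expr0n subn_eq0 leqNgt mn mulr0 ?mul0r.
Qed.

Lemma polar_coefD g h x m c d : polar_coef g x m c -> polar_coef h x m d ->
  polar_coef (g + h) x m (c + d).
Proof.
move=> [A [B [rB -> eA]]] [A' [B' [rB' -> eA']]].
have B0 := nroot_neq0 rB; have B'0 := nroot_neq0 rB'.
have Y0 := XsubC_exp_neq0 x m.
exists (A * B' + A' * B), (B * B'); split.
- by rewrite rootM negb_or rB.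
- rewrite addf_div ?tofrac_eq0 ?mulf_neq0 // -!tofracM -tofracD.
  by apply/eqP; rewrite div_crossE ?mulf_neq0 //; apply/eqP; ring.
- by rewrite hornerD !hornerM eA eA'; ring.
Qed.

Lemma polar_coefZ u g x m c :
  polar_coef g x m c -> polar_coef (u%:P%:F * g) x m (u * c).
Proof.
move=> [A [B [rB -> eA]]]; exists (u%:P * A), B; split=> //.
  by rewrite mulrA -tofracM.
by rewrite hornerM hornerC eA mulrA.
Qed.

(** Brings two functions to a common exponent, as [polar_coefD] requires. *)
Lemma polar_coefS g x m n c : polar_coef g x m c -> (m <= n)%N ->
  exists d, polar_coef g x n d.
Proof.
move=> h; rewrite leq_eqVlt => /predU1P [<-|/(polar_coefW h)].
  by exists c.
by exists 0.
Qed.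

Lemma pole_orderD g h x :
  (pole_order (g + h)%R x <= maxn (pole_order g x) (pole_order h x))%N.
Proof.
have [c [gc _]] := polar_coef_order g x.
have [d [hd _]] := polar_coef_order h x.
have [c' gc'] := polar_coefS gc (leq_maxl _ (pole_order h x)).
have [d' hd'] := polar_coefS hd (leq_maxr (pole_order g x) _).
by have [] := polar_coef_bound (polar_coefD gc' hd').
Qed.

Lemma pole_orderZ u g x : u != 0 -> pole_order (u%:P%:F * g) x = pole_order g x.
Proof.
have le v k : (pole_order (v%:P%:F * k)%R x <= pole_order k x)%N.
  have [c [gc _]] := polar_coef_order k x.
  by have [] := polar_coef_bound (polar_coefZ v gc).
move=> u0; apply/eqP; rewrite eqn_leq le /=.
(* The inequality applied to g = u^-1 (u g) gives the converse one. *)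
rewrite -{1}[g]mul1r -tofrac1 -polyC1 -(mulVf u0) polyCM tofracM -mulrA.
exact: le.
Qed.

Lemma pole_orderN g x : pole_order (- g) x = pole_order g x.
Proof.
rewrite -(@pole_orderZ (-1)) ?oppr_eq0 ?oner_eq0 //.
by rewrite polyCN tofracN polyC1 tofrac1 mulN1r opprK.
Qed.

Lemma pole_orderDl g h x : pole_order h x = 0%N ->
  pole_order (g + h) x = pole_order g x.
Proof.
move=> h0; apply/eqP; rewrite eqn_leq.
have := pole_orderD g h x; rewrite h0 maxn0 => -> /=.
have := pole_orderD (g + h) (- h) x.
by rewrite addrK pole_orderN h0 maxn0.
Qed.

End PoleOrders.

(** * Maxima and finiteness of poles *)

Lemma largest_gt0 (D : set nat) d : (0 < d)%N -> D d -> (0 < largest D)%E.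
Proof.
move=> d0 Dd; rewrite /largest; case: pselect => [h|_]; last exact: lt0y.
case: (cid2 h) => /= e _ /(_ _ Dd) de.
by rewrite lte_fin ltz_nat (leq_trans d0).
Qed.

Lemma poles_pigeonhole (K : fieldType) (h : {fraction {poly K}}) (a : nat -> K) :
  (forall n, pole h (a n)) -> exists i j, (i < j)%N /\ a i = a j.
Proof.
move=> ha; have [s es] := (finite_seqP _).1 (finite_poles h).
have has n : a n \in s.
  by have := ha n; rewrite es.
have /(uniqPn 0) [i [j [ij]]] : ~~ uniq [seq a i | i <- iota 0 (size s).+1].
  apply/negP => uq.
  have /(uniq_leq_size uq) : {subset [seq a i | i <- iota 0 (size s).+1] <= s}.
    by move=> y /mapP [n _ ->].
  by rewrite size_map size_iota ltnn.
rewrite size_map size_iota => js.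
rewrite !(nth_map 0%N) ?size_iota ?(ltn_trans ij) // !nth_iota ?(ltn_trans ij) //.
by move=> eij; exists i, j.
Qed.

(** The pole beta makes the range of the maximum nonempty, so its default value 0 does not
    intervene. *)
Lemma mahler_ord_const (K : fieldType) (f : {fraction {poly K}}) (tau : set K)
    (beta : K) (n : nat) : sing f tau beta ->
  (forall alpha, sing f tau alpha -> pole_order f alpha = n) ->
  mahler_ord f tau = n.
Proof.
move=> sb sn.
have /finite_seqP [s es] : finite_set (sing f tau).
  by apply: sub_finite_set (finite_poles f) => x [].
have {}es : sing f tau = [set` undup s]%classic.
  by rewrite es; apply/seteqP; split=> x /=; rewrite mem_undup.
rewrite /mahler_ord es -fsbig_seq ?undup_uniq //.
have bs : beta \in undup s by move: sb; rewrite es.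
apply/eqP; rewrite eqn_leq; apply/andP; split.
  by apply/bigmax_leqP_seq => x xs _; rewrite sn // es.
by rewrite -(sn _ sb); apply: (@leq_bigmax_seq _ _ xpredT).
Qed.

(** * Laurent parts and their coefficients under sigma *)

Section LaurentPart.
Variable K : fieldType.
Implicit Types (f g : {fraction {poly K}}) (A B P : {poly K}) (c : laurent K).

Lemma coprimep_XE B : coprimep 'X B = ~~ root B 0.
Proof. by rewrite coprimep_sym -['X]subr0 -polyC0 coprimep_XsubC. Qed.

(** Division by [gcdp A B] reduces A/B, after which uniqueness of the decomposition applies. *)
Lemma f_infty_unique f c A B : f = laurent_frac c + A%:F / B%:F ->
  (size A < size B)%N -> coprimep 'X B -> f_infty f = c.
Proof.
move=> ef szAB cX.
have B0 : B != 0 by rewrite -size_poly_gt0 (leq_ltn_trans _ szAB).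
pose h := gcdp A B.
have h0 : h != 0 by rewrite gcdp_eq0 negb_and B0 orbT.
have eB : B %/ h * h = B by rewrite divpK // dvdp_gcdr.
have eA : A %/ h * h = A by rewrite divpK // dvdp_gcdl.
have Bh0 : B %/ h != 0 by rewrite dvdp_div_eq0 // dvdp_gcdr.
have [A' [B' dec]] := f_inftyP f.
suff dec' : mahler_decomp f c (A %/ h) (B %/ h).
  by have [] := mahler_decomp_unique dec dec'.
split.
- rewrite ef; congr (_ + _); apply/eqP; rewrite div_crossE //.
  by rewrite -{1}eA -{2}eB mulrAC mulrA.
- right; have [->|A0] := eqVneq (A %/ h) 0.
    by rewrite size_poly0 size_poly_gt0.
  by rewrite -(@ltn_size_mulr _ _ _ h) // eA eB.
- by apply: coprimep_div_gcd; rewrite B0 orbT.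
- by move: cX; rewrite -{1}eB coprimepMr => /andP[].
Qed.

Lemma laurent_of_poly P (n : nat) : exists c,
  (forall j : nat, c (j%:Z - n%:Z) = P`_j) /\
  (forall i : int, i < - n%:Z -> c i = 0).
Proof.
pose s : {fset int} := [fset (j%:Z - n%:Z) | j in iota 0 (size P)]%fset.
exists [fsfun i in s => P`_(absz ((i : int) + n%:Z)%R)]; split=> [j|i im].
  rewrite fsfunE subrK absz_nat; case: ifPn => // js.
  rewrite nth_default // leqNgt; apply: contraNN js => js.
  by apply/imfsetP; exists j => //=; rewrite mem_iota.
rewrite fsfunE; case: ifPn => // /imfsetP [j _ ej].
by move: im; rewrite ej; lia.
Qed.

Lemma laurent_frac_const c : (forall i, i != 0 -> c i = 0) ->
  laurent_frac c = (c 0)%:P%:F.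
Proof.
move=> h; rewrite (@laurent_fracE _ c 0 (c 0)%:P).
- by rewrite expr0 tofrac1 divr1.
- by move=> j; rewrite subr0 coefC; case: j => [|j] //=; apply: h.
- by move=> i i0; apply: h; rewrite lt_eqF // -oppr0.
Qed.

Lemma laurent_frac_eq_const c (a : K) : laurent_frac c = a%:P%:F -> c 0 = a.
Proof.
have [M hM] := laurent_bound c.
have [cP ->] := laurent_polyP hM; set P := \poly_(_ < _) _ in cP *.
rewrite -[RHS]divr1 -tofrac1 => /eqP.
rewrite div_crossE ?oner_neq0 ?monic_neq0 ?monicXn // mulr1 => /eqP e.
by rewrite -(subrr M%:Z) cP e coefCM coefXn eqxx mulr1.
Qed.

Variable p : nat.
Hypothesis p_gt0 : (0 < p)%N.

Lemma comp_polyXn_neq0 B : B != 0 -> B \Po 'X^p != 0.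
Proof. by move=> B0; rewrite comp_poly_eq0 // size_polyXn ltnS. Qed.

Lemma mahler_sigmaD f g :
  mahler_sigma p (f + g) = mahler_sigma p f + mahler_sigma p g.
Proof.
have [A [B [B0 _ ->]]] := frac_reduced f.
have [A' [B' [B'0 _ ->]]] := frac_reduced g.
rewrite addf_div ?tofrac_eq0 // -!tofracM -tofracD !mahler_sigma_div ?mulf_neq0 //.
rewrite addf_div ?tofrac_eq0 ?comp_polyXn_neq0 //.
by rewrite -!tofracM -tofracD comp_polyD !comp_polyM.
Qed.

Lemma ltn_size_comp_polyXn A B : (size A < size B)%N ->
  (size (A \Po 'X^p) < size (B \Po 'X^p))%N.
Proof.
have [->|A0] := eqVneq A 0.
  by rewrite comp_poly0 size_poly0 !size_poly_gt0 => /comp_polyXn_neq0.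
move=> szAB; have B0 : B != 0 by rewrite -size_poly_gt0 (leq_ltn_trans _ szAB).
have sz (C : {poly K}) : C != 0 -> size (C \Po 'X^p) = ((size C).-1 * p).+1.
  move=> C0; rewrite -[size (C \Po _)]prednK ?size_poly_gt0 ?comp_polyXn_neq0 //.
  by rewrite size_comp_poly size_polyXn.
rewrite !sz // ltnS ltn_pmul2r //; move: szAB A0; rewrite -size_poly_gt0.
by case: (size A) => // a; case: (size B).
Qed.

Lemma ltn_size_mul2r A B C : (size A < size B)%N -> C != 0 ->
  (size (A * C)%R < size (B * C)%R)%N.
Proof.
move=> szAB C0.
have B0 : B != 0 by rewrite -size_poly_gt0 (leq_ltn_trans _ szAB).
have [->|A0] := eqVneq A 0; last by rewrite ltn_size_mulr.
by rewrite mul0r size_poly0 size_poly_gt0 mulf_neq0.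
Qed.

(** Substituting X^p maps Laurent polynomials to Laurent polynomials and keeps proper fractions
    proper with denominators prime to X, so the Laurent part evolves on its own. *)
Lemma f_infty_delta (u : K) g : let c := f_infty g in
  let c' := f_infty (u%:P%:F * mahler_sigma p g - g) in
  (forall i : int, c' (p%:Z * i) = u * c i - c (p%:Z * i)) /\
  (forall i : int, ~~ (p%:Z %| i)%Z -> c' i = - c i).
Proof.
move=> c; have [A [B [eg szAB _ cX]]] := f_inftyP g; rewrite -/c in eg.
have B0 : B != 0 by apply: (@nroot_neq0 _ _ 0); rewrite -coprimep_XE.
have {}szAB : (size A < size B)%N.
  by case: szAB => [->|//]; rewrite size_poly0 size_poly_gt0.
have [M hM] := laurent_bound c.
have [cP eP] := laurent_polyP hM; set P := \poly_(_ < _) _ in cP eP.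
(* X^(p M) is a common denominator of P/X^M and of its image under sigma. *)
have [N eN] : exists N, N = (p * M)%N by exists (p * M)%N.
pose R := u%:P * (P \Po 'X^p) - P * 'X^(N - M).
have [c' [cR c'0]] := laurent_of_poly R N.
have MN : (M <= N)%N by rewrite eN leq_pmull.
have Xn0 n : 'X^n != 0 :> {poly K} by rewrite monic_neq0 // monicXn.
have Bp0 := comp_polyXn_neq0 B0.
have ec' : f_infty (u%:P%:F * mahler_sigma p g - g) = c'.
  apply: (@f_infty_unique _ _ (u%:P * ((A \Po 'X^p) * B) - A * (B \Po 'X^p))
            ((B \Po 'X^p) * B)).
  - rewrite {1 2}eg eP mahler_sigmaD !mahler_sigma_div // (laurent_fracE cR c'0).
    rewrite comp_Xn_poly -exprM -eN.
    have -> : (A%:F / B%:F) = (A * (B \Po 'X^p))%:F / ((B \Po 'X^p) * B)%:F.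
      by apply/eqP; rewrite div_crossE ?mulf_neq0 //; apply/eqP; ring.
    have -> : (A \Po 'X^p)%:F / (B \Po 'X^p)%:F
              = ((A \Po 'X^p) * B)%:F / ((B \Po 'X^p) * B)%:F.
      by apply/eqP; rewrite div_crossE ?mulf_neq0 //; apply/eqP; ring.
    have -> : P%:F / ('X^M)%:F = (P * 'X^(N - M))%:F / ('X^N)%:F.
      by apply/eqP; rewrite div_crossE // -mulrA -exprD subnK.
    by rewrite /R !tofracB ![(u%:P * _)%:F]tofracM; ring.
  - apply: leq_ltn_trans (size_polyD _ _) _; rewrite size_polyN gtn_max.
    rewrite mulrA ltn_size_mul2r //=; last first.
      rewrite mul_polyC (leq_ltn_trans (size_scale_leq _ _)) //.
      exact: ltn_size_comp_polyXn.
    by rewrite [(B \Po _) * B]mulrC ltn_size_mul2r.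
  - rewrite coprimep_XE rootM negb_or {1}/root horner_comp hornerXn.
    by rewrite expr0n eqn0Ngt p_gt0 -rootE andbb -coprimep_XE.
rewrite ec'.
(* Both claims in one formula: sigma moves the coefficient at q to p q and leaves 0 at the other
   indices. *)
have shift (i : int) : c' i =
    u * (if (p%:Z %| i)%Z then c (i %/ p%:Z)%Z else 0) - c i.
  have [iN|iN] := ltP i (- N%:Z).
    rewrite c'0 // (hM i); last by lia.
    case: ifP => [/dvdzP [q eq]|_]; last by rewrite mulr0 subr0.
    rewrite eq mulzK ?hM ?mulr0 ?subr0 //; last by lia.
    by move: iN; rewrite eq eN; nia.
  have [j ej] : exists j : nat, i = j%:Z - N%:Z.
    by exists (absz (i + N%:Z)); lia.
  rewrite {1}ej cR coefB coefCM coef_comp_poly_Xn // coefMXn.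
  congr (u * _ - _).
    (* p divides N, so the shift by N preserves divisibility by p. *)
    have -> : (p%:Z %| i)%Z = (p %| j)%N.
      by rewrite ej eN PoszM rpredBr ?dvdz_mulr.
    case: ifP => // /dvdnP [q eq]; rewrite eq mulnK // -cP; congr (c _).
    rewrite ej eq eN !PoszM [(p%:Z * _)]mulrC -mulrBl mulzK //.
    by rewrite -lt0n.
  case: ltnP => jN.
    by rewrite hM //; lia.
  by rewrite -cP; congr (c _); lia.
split=> i; last by move=> /negPf pi; rewrite shift pi mulr0 add0r.
by rewrite shift dvdz_mulr // mulKz // -lt0n.
Qed.

End LaurentPart.

(** * The substitution of x^p for x in characteristic zero *)

Section Mahler.
Variables (K : closedFieldType) (p : nat).
Hypotheses (charK : [pchar K] =i pred0) (p_gt1 : (2 <= p)%N).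
Implicit Types (f g : {fraction {poly K}}) (x c u : K).

Let p_gt0 : (0 < p)%N := ltnW p_gt1.

Lemma char0_p_neq0 : p%:R != 0 :> K.
Proof. by rewrite ((pcharf0P K).1 charK) -lt0n. Qed.

(** X^p - x^p = (X - x) Q with Q(x) = p x^(p-1), nonzero since x is nonzero and the characteristic
    is 0. The factor Q^m joins the cofactor and divides the coefficient by Q(x)^m. *)
Lemma polar_coef_sigma g x m c : x != 0 -> polar_coef g (x ^+ p) m c ->
  polar_coef (mahler_sigma p g) x m (c / (p%:R * x ^+ p.-1) ^+ m).
Proof.
move=> x0 [A [B [rB -> eA]]].
have B0 := nroot_neq0 rB.
rewrite mahler_sigma_div ?mulf_neq0 ?XsubC_exp_neq0 //.
pose Q : {poly K} := \sum_(i < p) 'X ^+ (p.-1 - i) * x%:P ^+ i.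
have eQ : 'X^p - (x ^+ p)%:P = ('X - x%:P) * Q by rewrite polyC_exp subrXX.
have Qx : Q.[x] = p%:R * x ^+ p.-1.
  rewrite horner_sum (eq_bigr (fun=> x ^+ p.-1)).
    by rewrite sumr_const card_ord mulr_natl.
  move=> i _; rewrite -polyC_exp hornerM hornerXn hornerC -exprD subnK //.
  by rewrite -ltnS prednK.
have Qx0 : Q.[x] != 0 by rewrite Qx mulf_neq0 ?char0_p_neq0 // expf_neq0.
exists (A \Po 'X^p), (Q ^+ m * (B \Po 'X^p)); split.
- rewrite rootM negb_or {2}/root horner_comp hornerXn.
  by rewrite /root horner_exp expf_neq0.
- by rewrite comp_polyM rmorphXn /= comp_polyB comp_polyX comp_polyC eQ exprMn mulrA.
- rewrite hornerM !horner_comp hornerXn eA horner_exp Qx mulrA divfK //.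
  by rewrite -Qx expf_neq0.
Qed.

Lemma pole_order_sigma g x : x != 0 ->
  pole_order (mahler_sigma p g) x = pole_order g (x ^+ p).
Proof.
move=> x0; have [c [gc c0]] := polar_coef_order g (x ^+ p).
have [] := polar_coef_bound (polar_coef_sigma x0 gc).
case: (posnP (pole_order g (x ^+ p))) => [->|/c0 cn0] le eq.
  by apply/eqP; rewrite -leqn0.
apply: eq; rewrite mulf_neq0 // invr_eq0 expf_neq0 //.
by rewrite mulf_neq0 ?char0_p_neq0 // expf_neq0.
Qed.

(** Puts the scalar of [mahler_delta] in the form to which [polar_coefZ] and [pole_orderZ] apply. *)
Lemma fracC_expz (lam : int) :
  p%:R ^ lam = (p%:R ^ lam : K)%:P%:F :> {fraction {poly K}}.
Proof.
case: lam => n; first by rewrite -!exprnP polyC_exp tofracXn polyC_natr rmorph_nat.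
rewrite NegzE -!exprnN.
have e : ((p%:R : K) ^+ n.+1)%:P%:F = p%:R ^+ n.+1 :> {fraction {poly K}}.
  by rewrite polyC_exp tofracXn polyC_natr rmorph_nat.
have p0 := expf_neq0 n.+1 char0_p_neq0.
by rewrite -e; apply: mulr1_eq; rewrite -tofracM -polyCM divff.
Qed.

Lemma mahler_deltaE (lam : int) g :
  mahler_delta p lam g = (p%:R ^ lam : K)%:P%:F * mahler_sigma p g - g.
Proof. by rewrite /mahler_delta fracC_expz. Qed.

(** For z = n >= 0, p^(n k) - 1 vanishes in characteristic 0, hence as a natural number; negative
    exponents are inverted. *)
Lemma char0_p_expz_eq1 (z : int) (k : nat) : (0 < k)%N ->
  ((p%:R : K) ^ z) ^+ k = 1 -> z = 0.
Proof.
have aux n : (0 < k)%N -> ((p%:R : K) ^+ n) ^+ k = 1 -> n = 0%N.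
  rewrite -exprM -natrX => k0 /eqP.
  rewrite -subr_eq0 -[X in _ - X]/(1%:R) -natrB ?expn_gt0 ?p_gt0 //.
  rewrite ((pcharf0P K).1 charK) subn_eq0 -(expn0 p) leq_exp2l //.
  by rewrite leqn0 muln_eq0 orbC -leqn0 leqNgt k0 => /eqP.
case: z => n k0; first by rewrite -exprnP => /(aux _ k0) ->.
rewrite NegzE -exprnN exprVn => /eqP; rewrite invr_eq1 => /eqP.
by move=> /(aux _ k0).
Qed.

Lemma exp_root_exists (x : K) : exists y, y ^+ p = x.
Proof.
have [|y] := @closed_rootP K ('X^p - x%:P) _.
  by rewrite size_XnsubC // eqSS -lt0n.
by rewrite rootE !hornerE subr_eq0 => /eqP <-; exists y.
Qed.

(** The order of x divides p^k - 1, which is coprime to p. *)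
Lemma periodic_primitive_root (x : K) (k : nat) : x != 0 -> (0 < k)%N ->
  x ^+ (p ^ k) = x -> exists2 n : nat, coprime n p & n.-primitive_root x.
Proof.
move=> x0 k0 xk.
have pk1 : (1 < p ^ k)%N by rewrite -(expn0 p) ltn_exp2l.
have pk0 : (0 < (p ^ k).-1)%N by rewrite -ltnS prednK // ltnW.
have xk1 : x ^+ (p ^ k).-1 = 1.
  by apply: (mulfI x0); rewrite -exprS prednK ?mulr1 // ltnW.
have [n hn dn] := prim_order_exists pk0 xk1.
exists n => //; apply: coprime_dvdl dn _.
by rewrite -(@coprime_pexpr k) // coprimePn // ltnW.
Qed.

(** * Poles and dispersion of p^lam sigma(g) - g *)

Section Delta.
Variables (lam : int) (g : {fraction {poly K}}).

Let f := mahler_delta p lam g.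
Let u : K := p%:R ^ lam.
Let u_neq0 : u != 0 := expfz_neq0 lam char0_p_neq0.

Lemma pole_order_delta_g0 x : x != 0 -> pole_order g x = 0%N ->
  pole_order f x = pole_order g (x ^+ p).
Proof.
move=> x0 gx; rewrite /f mahler_deltaE pole_orderDl ?pole_orderN //.
by rewrite pole_orderZ // pole_order_sigma.
Qed.

Lemma pole_order_delta_gp0 x : x != 0 -> pole_order g (x ^+ p) = 0%N ->
  pole_order f x = pole_order g x.
Proof.
move=> x0 gx; rewrite /f mahler_deltaE addrC pole_orderDl ?pole_orderN //.
by rewrite pole_orderZ // pole_order_sigma.
Qed.

(** p^lam sigma(g) = g + f, and adding a function regular at x keeps the pole order. *)
Lemma pole_order_delta0 x : x != 0 -> pole_order f x = 0%N ->
  pole_order g x = pole_order g (x ^+ p).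
Proof.
move=> x0 fx; rewrite -[RHS]pole_order_sigma // -[RHS](@pole_orderZ _ u) //.
have -> : u%:P%:F * mahler_sigma p g = g + f by rewrite /f mahler_deltaE addrC subrK.
by rewrite pole_orderDl.
Qed.

(* Successive p-th roots of beta are not poles of f, hence all inherit the pole
   of g at beta; as g has finitely many poles, two of them coincide. *)
Lemma periodic_of_backward_regular (beta : K) : beta != 0 -> pole g beta ->
  (forall eta k, (0 < k)%N -> eta ^+ (p ^ k) = beta -> ~ pole f eta) ->
  exists k, (0 < k)%N /\ beta ^+ (p ^ k) = beta.
Proof.
move=> b0 gb hf; have [r hr] := choice exp_root_exists.
pose b n := iter n r beta.
have bE i n : b (i + n)%N ^+ (p ^ i) = b n.
  elim: i => [|i IH]; first by rewrite expn0 expr1.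
  by rewrite addSn expnS exprM hr.
have bn0 n : b n != 0.
  by have := bE n 0%N; rewrite addn0; apply: contra_eq_neq => ->;
     rewrite expr0n expn_eq0 -[p == _]leqn0 leqNgt p_gt0 eq_sym.
have gbn n : pole g (b n).
  elim: n => [//|n IH]; rewrite /pole pole_order_delta0 ?hr //.
  have := hf (b n.+1) n.+1 isT; rewrite -[in b _](addn0 n.+1) bE => /(_ erefl).
  by rewrite /pole => /negP; rewrite addn0 -eqn0Ngt => /eqP.
have [i [j [ij eij]]] := poles_pigeonhole gbn.
exists (j - i)%N; rewrite subn_gt0; split=> //.
(* Raise b i = b j to the power p^i. *)
have e : b (j - i)%N = beta.
  by have := bE i 0%N; rewrite addn0 eij -{1}(subnKC (ltnW ij)) bE.
by have := bE (j - i)%N 0%N; rewrite addn0 e.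
Qed.

(* Cancellation of the leading polar coefficients c in p^lam sigma(g) - g gives
   d x = p^(lam - m) * d (x^p) for d x := c x / x^m; going once around the cycle
   yields p^(k (lam - m)) = 1. *)
Lemma cycle_pole_order (x : K) (k : nat) : x != 0 -> (0 < k)%N ->
  x ^+ (p ^ k) = x -> (forall j, pole_order f (x ^+ (p ^ j)) = 0%N) ->
  pole g x -> lam = pole_order g x.
Proof.
move=> x0 k0 xk fx; rewrite /pole; set m := pole_order g x => m0.
pose y j := x ^+ (p ^ j).
have yS j : y j ^+ p = y j.+1 by rewrite /y expnSr exprM.
have y0 j : y j != 0 by rewrite expf_neq0.
have gy j : pole_order g (y j) = m.
  elim: j => [|j IH]; first by rewrite /y expn0 expr1.
  by rewrite -yS -(pole_order_delta0 (y0 j) (fx j)).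
have [c hc] := choice (polar_coef_order g).
pose d j := c (y j) / y j ^+ m.
pose v : K := p%:R ^ (lam - m%:Z).
have frac_rearrange (a b P Y Z : K) : a * (b / (P * Z)) / Y = a / P * (b / (Y * Z)).
  by rewrite !invfM; ring.
have p0 := char0_p_neq0.
have vE : v = u / p%:R ^+ m by rewrite /v expfzDr // -exprnN.
have dS j : d j = v * d j.+1.
  have [gj _] := hc (y j); have [gj' _] := hc (y j.+1).
  rewrite gy in gj; rewrite gy -yS in gj'.
  have := polar_coefD (polar_coefZ u (polar_coef_sigma (y0 j) gj'))
                      (polar_coefZ (-1) gj).
  rewrite polyCN tofracN polyC1 tofrac1 !mulN1r -mahler_deltaE.
  case/polar_coef_bound => _; rewrite -/f fx => h.
  (* A nonzero value would be the leading coefficient of a pole of f of order m > 0. *)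
  have /eqP : u * (c (y j ^+ p) / (p%:R * y j ^+ p.-1) ^+ m) - c (y j) = 0.
    by apply/eqP/negPn/negP => /h m0'; move: m0; rewrite -m0'.
  rewrite subr_eq0 => /eqP e; rewrite /d -e vE -yS.
  (* The normalisation of d by the m-th power of the point absorbs the factor y^(p-1) this way. *)
  have -> : (y j ^+ p) = y j * y j ^+ p.-1 by rewrite -exprS prednK.
  by rewrite !exprMn; apply: frac_rearrange.
have dk : d 0%N = v ^+ k * d k.
  elim: k {k0 xk} => [|k IH]; first by rewrite mul1r.
  by rewrite IH dS exprSr mulrA.
have d0 : d 0%N != 0.
  by rewrite mulf_neq0 ?invr_eq0 ?expf_neq0 // (hc _).2 // gy.
have : v ^+ k = 1.
  apply: (mulIf d0); rewrite mul1r [RHS]dk; congr (_ * _).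
  by rewrite /d /y xk expn0 expr1.
by move/(char0_p_expz_eq1 k0)/eqP; rewrite subr_eq0 => /eqP.
Qed.

(** Stated for a single pole, so that it serves both for lam <= 0, where no pole has order lam, and
    for lam >= 1, where it is applied to every pole in turn. *)
Lemma disp_tree_gt0 (tau : set K) (beta : K) :
  is_mahler_tree p tau -> sing f tau beta ->
  tree_cycle p tau = set0 \/ (pole_order f beta)%:Z <> lam ->
  (0 < disp_tree p f tau)%E.
Proof.
move=> [a0 a00 etau] [tb fb] hyp; apply: contrapT => nd.
(* A p^d-th power with d > 0 never joins two poles of f in tau, not even a pole to itself. *)
have Dno d alpha : (0 < d)%N -> tau alpha -> pole f alpha ->
    tau (alpha ^+ (p ^ d)) -> pole f (alpha ^+ (p ^ d)) -> False.
  by move=> d0 *; apply: nd; apply: (@largest_gt0 _ d d0); exists alpha.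
have tau0 x : tau x -> x != 0 by rewrite etau => -[].
have tau_exp x j : tau x -> tau (x ^+ (p ^ j)).
  rewrite etau => -[x0 [r [s e]]]; split; first by rewrite expf_neq0.
  by exists (r + j)%N, s; rewrite expnD exprM e -!exprM mulnC.
have tau_root x j : tau (x ^+ (p ^ j)) -> tau x.
  rewrite etau => -[x0 [r [s e]]]; split.
    by apply: contraNneq x0 => ->; rewrite expr0n expn_eq0 eqn0Ngt p_gt0.
  by exists r, (j + s)%N; rewrite e -exprM expnD.
have b0 := tau0 _ tb.
have fb0 j : (0 < j)%N -> pole_order f (beta ^+ (p ^ j)) = 0%N.
  move=> j0; apply/eqP; rewrite eqn0Ngt; apply/negP.
  exact: Dno j0 tb fb (tau_exp _ _ tb).
(* A pole of g at beta would make beta periodic, so that beta is joined to itself. *)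
have back : ~ pole g beta.
  move=> gb; have [|k [k0 e]] := periodic_of_backward_regular b0 gb.
    move=> eta k k0 e feta; apply: (Dno k eta); rewrite ?e //.
    by apply: (tau_root _ k); rewrite e.
  by apply: (Dno k beta); rewrite ?e.
have gb j : pole_order g (beta ^+ (p ^ j.+1)) = pole_order g (beta ^+ p).
  elim: j => [|j <-]; first by rewrite expn1.
  rewrite [in LHS]expnSr exprM -pole_order_delta0 ?fb0 //.
  by rewrite expf_neq0.
case: (posnP (pole_order g (beta ^+ p))) => [g0|g0].
  by apply: back; rewrite /pole -pole_order_delta_gp0.
have [|i [j [ij eij]]] := @poles_pigeonhole _ g (fun n => beta ^+ (p ^ n.+1)) _.
  by move=> n; rewrite /pole gb.
(* The exponent i+1 keeps the orbit of x among the beta^(p^j) with j > 0, where f is regular. *)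
pose x := beta ^+ (p ^ i.+1).
have tx : tau x by apply: tau_exp.
have k0 : (0 < j - i)%N by rewrite subn_gt0.
have xk : x ^+ (p ^ (j - i)) = x.
  by rewrite /x -exprM -expnD addSn subnKC ?(ltnW ij) // -eij.
have elam : lam = pole_order g (beta ^+ p).
  rewrite -(gb i); apply: (cycle_pole_order (tau0 _ tx) k0 xk).
    by move=> l; rewrite /x -exprM -expnD fb0.
  by rewrite /pole gb.
case: hyp => [c0|]; last first.
  (* As g is regular at beta, f has there the order of g at beta^p. *)
  apply; rewrite elam; congr Posz; apply: pole_order_delta_g0 => //.
  by apply/eqP; rewrite eqn0Ngt; apply/negP.
suff : tree_cycle p tau x by rewrite c0.
by split=> //; apply: (periodic_primitive_root (tau0 _ tx) k0).
Qed.

Lemma disp_infty_gt0 : laurent_frac (f_infty f) != 0 ->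
  lam = 0 \/ ~ (exists a : K, laurent_frac (f_infty f) = a%:P%:F) ->
  (0 < disp_infty p f)%E.
Proof.
move=> f0 hyp; have [] := f_infty_delta p_gt0 u g.
rewrite -mahler_deltaE -/f; set c := f_infty g; set c' := f_infty f in f0 hyp *.
move=> cp cn; rewrite /disp_infty -/c'; case: pselect => [[a ea]|nconst].
  (* For lam = 0 the constant coefficient of f is c 0 - c 0 = 0, so the Laurent part would
     vanish. *)
  case: hyp => [l0|[]]; last by exists a.
  have := cp 0; rewrite mulr0 /u l0 expr0z mul1r subrr (laurent_frac_eq_const ea).
  by move=> a0; case/eqP: f0; rewrite ea a0 polyC0 tofrac0.
have [i [i0 c'i]] : exists i, i != 0 /\ c' i != 0.
  apply: contrapT => h; apply: nconst; exists (c' 0).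
  apply: laurent_frac_const => i i0; apply/eqP/negPn/negP => ci.
  by apply: h; exists i.
pose nz n := `[< exists j, [/\ j != 0, c j != 0 & `|j|%N = n] >].
have exnz : exists n, nz n.
  suff [j j0 cj] : exists2 j, j != 0 & c j != 0.
    by exists `|j|%N; apply/asboolP; exists j.
  (* If c vanished off 0, so would c', against the choice of i. *)
  apply: contrapT => h.
  have c0 j : j != 0 -> c j = 0.
    by move=> j0; apply/eqP/negPn/negP => cj; apply: h; exists j.
  move: c'i; case: (boolP (p%:Z %| i)%Z) => [/dvdzP [q eq]|/cn ->].
    have q0 : q != 0 by apply: contraNneq i0 => q0; rewrite eq q0 mul0r.
    by rewrite eq mulrC cp [p%:Z * _]mulrC -eq (c0 i i0) (c0 q q0) mulr0 subr0 eqxx.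
  by rewrite c0 // oppr0 eqxx.
have [_ /asboolP [j [j0 cj <-]] jmin] := ex_minnP exnz.
(* If p divides j, minimality of |j| gives c (j / p) = 0; so c' j = - c j in either case. *)
have c'j : c' j != 0.
  case: (boolP (p%:Z %| j)%Z) => [/dvdzP [q eq]|/cn ->]; last by rewrite oppr_eq0.
  have q0 : q != 0 by apply: contraNneq j0 => q0; rewrite eq q0 mul0r.
  suff cq : c q = 0 by rewrite eq mulrC cp cq mulr0 add0r oppr_eq0 mulrC -eq.
  apply/eqP/negPn/negP => cq.
  have : nz `|q|%N by apply/asboolP; exists q.
  move/jmin; rewrite {1}eq abszM leqNgt absz_nat.
  by rewrite ltn_Pmulr // absz_gt0.
have [M hM] := laurent_bound c.
have exa : exists a : nat, c (j * p%:Z ^+ a) != 0 by exists 0%N; rewrite mulr1.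
have [a ca amax] : exists2 a : nat, c (j * p%:Z ^+ a) != 0
    & forall b : nat, c (j * p%:Z ^+ b) != 0 -> (b <= a)%N.
  (* |j p^b| >= p^b > b, so for b > M the index leaves the support of c. *)
  have bd (b : nat) : c (j * p%:Z ^+ b) != 0 -> (b <= M)%N.
    apply: contraR; rewrite -ltnNge => Mb; apply/eqP/hM.
    rewrite abszM abszX absz_nat; apply: (leq_trans (ltn_trans Mb (ltn_expl b p_gt1))).
    by rewrite leq_pmull // absz_gt0.
  by have [a ca amax] := ex_maxnP exa bd; exists a.
(* By maximality of a, only p^lam c (j p^a) contributes to c' at j p^(a+1). *)
apply: (@largest_gt0 _ a.+1) => //; exists j; split=> //.
rewrite exprSr mulrA [_ * p%:Z]mulrC cp.
suff -> : c (p%:Z * (j * p%:Z ^+ a)) = 0 by rewrite subr0 mulf_neq0.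
rewrite mulrC -mulrA -exprSr; apply/eqP/negPn/negP => /amax.
by rewrite ltnn.
Qed.

End Delta.

End Mahler.

Theorem theorem4p2 (K : closedFieldType) (charK : [pchar K] =i pred0)
    (p : nat) (hp : (2 <= p)%N) (lam : int) (f : {fraction {poly K}})
    (hf : mahler_summable p lam f) :
  [/\ (* 1 *)
      mahler_supp p f AtInfty ->
      lam = 0 \/ ~ (exists c : K, laurent_frac (f_infty f) = c%:P%:F) ->
      (0 < disp p f AtInfty)%E,
      (* 2 *)
      lam <= 0 ->
      forall tau : set K, mahler_supp p f (AtTree tau) ->
      (0 < disp p f (AtTree tau))%E
    & (* 3 *)
      1 <= lam ->
      forall tau : set K, mahler_supp p f (AtTree tau) ->
      tree_T0 p tau \/ (mahler_ord f tau)%:Z <> lam ->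
      (0 < disp p f (AtTree tau))%E].
Proof.
case: hf => g ->; split.
- exact: disp_infty_gt0.
- move=> lam0 tau [htau [beta tb pb]].
  apply: (disp_tree_gt0 charK hp htau (beta := beta)); first by split.
  by right; move: pb lam0; rewrite /pole; lia.
- move=> _ tau [htau [beta tb pb]] hyp.
  have sb : sing (mahler_delta p lam g) tau beta by split.
  case: hyp => [[_ c0]|ord].
    by apply: (disp_tree_gt0 charK hp htau sb); left.
  (* Without positive dispersion every pole of f in tau has order lam, hence so does the maximum. *)
  apply: contrapT => nd; apply: ord.
  have const x : sing (mahler_delta p lam g) tau x ->
      (pole_order (mahler_delta p lam g) x)%:Z = lam.
    move=> sx; apply: contrapT => ne; apply: nd.
    by apply: (disp_tree_gt0 charK hp htau sx); right.
  apply: etrans (const _ sb); congr Posz; apply: (mahler_ord_const sb) => x sx.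
  by apply/eqP; rewrite -eqz_nat (const _ sx) (const _ sb).
Qed.
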